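(* Let $(K,\Delta)$ be a Hermitian form field with $\bar{}=\mathrm{id}$, $\lambda=-1$, $\mu=0$ and $\Delta=\Delta_{\max}=K\times K$, where the field $K$ has characteristic $2$ and contains a nonzero element of multiplicative order $\geq 4$ (possibly infinite). Let $n\geq 3$ and $G=U_{2n+1}(K,\Delta)$. Let $\mathcal{C}$ denote the set of all conjugacy classes of $G$ of level $(K,\Delta)$ and let $S_{\mathrm{short}}$ denote the set of all nontrivial short root transvections in $G$. Then $\mathrm{scn}_{\mathcal{C}}(S_{\mathrm{short}})=4$.
   Context: Hermitian form fields. A Hermitian form field $(K,\Delta)$ consists of the following data. $K$ is a (commutative) field with a ring automorphism $x\mapsto\bar x$, an element $\lambda\in K$ with $\bar{\bar x}=\lambda x\bar\lambda$ for all $x\in K$ (hence $\bar\lambda=\lambda^{-1}$), and an element $\mu\in K$ with $\mu=\bar\mu\lambda$. The Heisenberg group $\mathfrak{H}$ is the set $K\times K$ with group operation $(x_1,y_1)\dot{+}(x_2,y_2)=(x_1+x_2,\,y_1+y_2-\bar x_1\mu x_2)$; the inverse of $(x,y)$ is $\dot{-}(x,y)=(-x,-y-\bar x\mu x)$, and $a\dot{-}b$ means $a\dot{+}(\dot{-}b)$. For $a\in K$ put $(x,y)\circ a=(xa,\bar a y a)$. A subgroup of $\mathfrak{H}$ stable under $\circ a$ for all $a\in K$ is called a $K^\bullet$-submodule. For $A\subseteq\mathfrak H$, $B\subseteq K$, $A\circ B$ denotes the subgroup of $\mathfrak H$ generated by all $a\circ b$, $a\in A,b\in B$. Put $\mathrm{tr}(x,y)=\bar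 x\mu x+y+\bar y\lambda$, $\Delta_{\min}=\{(0,x-\bar x\lambda)\mid x\in K\}$ and $\Delta_{\max}=\{(x,y)\in\mathfrak H\mid \mathrm{tr}(x,y)=0\}$. $\Delta$ is a $K^\bullet$-submodule of $\mathfrak H$ with $\Delta_{\min}\subseteq\Delta\subseteq\Delta_{\max}$. Odd form ideals. Put $J(\Delta)=\{y\in K\mid \exists z\in K: (y,z)\in\Delta\}$. For an ideal $I$ of $K$ with $\bar x\in I$ for all $x\in I$, put $\tilde I=\{x\in K\mid \overline{J(\Delta)}\mu x\subseteq I\}$, $\Omega^I_{\min}=\{(0,x-\bar x\lambda)\mid x\in I\}\dot{+}\Delta\circ I$ and $\Omega^I_{\max}=\Delta\cap(\tilde I\times I)$. An odd form ideal of $(K,\Delta)$ is a pair $(I,\Omega)$ where $I$ is an ideal of $K$ with $\bar x\in I$ for all $x\in I$ and $\Omega$ is a $K^\bullet$-submodule of $\mathfrak H$ with $\Omega^I_{\min}\subseteq\Omega\subseteq\Omega^I_{\max}$. The unitary group. Let $M=K^{2n+1}$ (column vectors) with standard basis indexed $(e_1,\dots,e_n,e_0,e_{-n},\dots,e_{-1})$; rows and columns of $(2n+1)\times(2n+1)$ matrices are indexed in the same way. Define $B(u,v)=\sum_{i=1}^n\bar u_iv_{-i}+\bar u_0\mu v_0+\sum_{i=-n}^{-1}\bar u_i\lambda v_{-i}$ and $Q(u)=(u_0,\sum_{i=1}^n\bar u_iu_{-i})\in\mathfrak H$. Then $U_{2n+1}(K,\Delta)$ is the group of all $\sigma\in GL_{2n+1}(K)$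 with $B(\sigma u,\sigma v)=B(u,v)$ and $Q(\sigma u)\dot{-}Q(u)\in\Delta$ for all $u,v\in M$. Transvections. Let $\Theta_{\mathrm{hb}}=\{\pm1,\dots,\pm n\}$, $\epsilon(i)=1$ if $i>0$ and $\epsilon(i)=-1$ if $i<0$. Let $e$ be the identity matrix and $e^{ij}$ the matrix units. Short root transvections are the matrices $T_{ij}(x)=e+xe^{ij}-\lambda^{(\epsilon(j)-1)/2}\bar x\lambda^{(1-\epsilon(i))/2}e^{-j,-i}$ with $i,j\in\Theta_{\mathrm{hb}}$, $i\neq\pm j$, $x\in K$. For a subset $\Omega\subseteq K\times K$ put $\Omega^{1}=\Omega$ and $\Omega^{-1}=\{(x,y)\mid (x,\bar y)\in\Omega\}$. Extra short root transvections are the matrices $T_i(x,y)=e+xe^{0,-i}-\lambda^{-(1+\epsilon(i))/2}\bar x\mu e^{i0}+ye^{i,-i}$ with $i\in\Theta_{\mathrm{hb}}$, $(x,y)\in\Delta^{-\epsilon(i)}$. All these lie in $U_{2n+1}(K,\Delta)$; nontrivial means different from $e$. $E=EU_{2n+1}(K,\Delta)$ is the subgroup generated by all short and extra short root transvections. Relative subgroups. Let $(I,\Omega)$ be an odd form ideal. $T_{ij}(x)$ is $(I,\Omega)$-elementary if $x\in I$; $T_i(x,y)$ is $(I,\Omega)$-elementary if $(x,y)\in\Omega^{-\epsilon(i)}$. $EU_{2n+1}((K,\Delta),(I,\Omega))$ is the normal closure in $E$ of the subgroup generated by all $(I,\Omega)$-elementary transvections. $U_{2n+1}((K,\Delta),(I,\Omega))$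 is the subgroup of all $\sigma\in U_{2n+1}(K,\Delta)$ with $\sigma_{ij}-\delta_{ij}\in I$ for all $i,j\in\Theta_{\mathrm{hb}}$ and $Q(\sigma u)\dot{-}Q(u)\in\Omega$ for all $u\in M$ with $u_0\in J(\Delta)$. $NU_{2n+1}((K,\Delta),(I,\Omega))$ is its normaliser in $U_{2n+1}(K,\Delta)$, and $CU_{2n+1}((K,\Delta),(I,\Omega))=\{\sigma\in NU_{2n+1}((K,\Delta),(I,\Omega))\mid [\sigma,E]\leq U_{2n+1}((K,\Delta),(I,\Omega))\}$. Level. Let $n\geq3$. It is known (Bak–Preusser) that for every subgroup $H$ of $U_{2n+1}(K,\Delta)$ normalised by $E$ there is a unique odd form ideal $(I,\Omega)$ with $EU_{2n+1}((K,\Delta),(I,\Omega))\subseteq H\subseteq CU_{2n+1}((K,\Delta),(I,\Omega))$; it is called the level of $H$. The level of a conjugacy class $C$ of $G=U_{2n+1}(K,\Delta)$ is the level of the subgroup generated by $C$. Covering numbers. For a group $G$ and subsets $S,X\subseteq G$, $\mathrm{cn}_X(S)$ is the least positive integer $m$ with $S\subseteq X^m=\{x_1\cdots x_m\mid x_i\in X\}$ ($\infty$ if there is none), and $\mathrm{scn}_X(S)=\mathrm{cn}_{X\cup X^{-1}}(S)$. For a set $\mathcal X$ of subsets of $G$, $\mathrm{scn}_{\mathcal X}(S)=\sup\{\mathrm{scn}_X(S)\mid X\in\mathcal X\}$. *)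

(* Defs.v *)
From HB Require Import structures.
From mathcomp Require Import all_boot all_order all_algebra.
From mathcomp Require Import boolp classical_sets.

Set Implicit Arguments.
Unset Strict Implicit.
Unset Printing Implicit Defensive.

Import Order.TTheory GRing.Theory Num.Theory.

Local Open Scope classical_set_scope.
Local Open Scope ring_scope.

(* Extended naturals are encoded as [option nat], with [None] as infinity;
   [least P] is the infimum of P, so that [least set0] is infinity. *)
Definition least (P : nat -> Prop) : option nat :=
  match pselect (exists m, `[< P m >]) with
  | left exP => Some (ex_minn exP)
  | right _ => None
  end.

Definition oleq (a : option nat) (m : nat) : Prop :=
  if a is Some k then (k <= m)%N else False.

Definition osup (A : set (option nat)) : option nat :=
  least (fun m => forall a, A a -> oleq a m).

(* Possibly infinite groups are handled as sets of units of a ring R. *)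
Section GroupNotions.
Variable R : unitRingType.
Implicit Types (A S X C H N E G : set R) (g x : R) (XX : set (set R)).

Definition is_subgroup H : Prop :=
  [/\ forall x, H x -> x \is a GRing.unit,
      H 1,
      forall x y, H x -> H y -> H (x * y)
    & forall x, H x -> H x^-1].

Definition gen A : set R := smallest is_subgroup A.

Definition is_normal_in E N : Prop :=
  [/\ is_subgroup N, N `<=` E & forall g x, E g -> N x -> N (g * x * g^-1)].

Definition normal_closure E A : set R := smallest (is_normal_in E) A.

Definition normaliser G H : set R :=
  [set g | G g /\ [set g * x * g^-1 | x in H] = H].

Definition commutator_subgroup g E : set R :=
  gen [set g * x * g^-1 * x^-1 | x in E].

Definition conjugacy_class G C : Prop :=
  exists2 g, G g & C = [set x * g * x^-1 | x in G].

Fixpoint setpow X (m : nat) : set R :=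
  if m is m'.+1 then [set x * y | x in X & y in setpow X m'] else [set 1].

Definition cn X S : option nat :=
  least (fun m => (0 < m)%N /\ S `<=` setpow X m).

Definition scn X S : option nat := cn (X `|` [set x^-1 | x in X]) S.

Definition scn_family XX S : option nat := osup [set scn X S | X in XX].

End GroupNotions.

(* A Hermitian form field without its form parameter Delta. *)
Record pre_hermitian (K : fieldType) := PreHermitian {
  bar : {rmorphism K -> K};
  bar_bij : bijective bar;
  lam : K;
  bar_barE : forall x, bar (bar x) = lam * x * bar lam;
  mu : K;
  mu_bar : mu = bar mu * lam
}.

Section Heisenberg.
Variables (K : fieldType) (F : pre_hermitian K).
Implicit Types (a b : K) (p q : K * K) (A W : set (K * K)) (B I : set K).

Definition hadd p q : K * K :=
  (p.1 + q.1, p.2 + q.2 - bar F p.1 * mu F * q.1).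

Definition hopp p : K * K := (- p.1, - p.2 - bar F p.1 * mu F * p.1).

Definition hsub p q : K * K := hadd p (hopp q).

Definition hact p a : K * K := (p.1 * a, bar F a * p.2 * a).

Definition is_hsubgroup W : Prop :=
  [/\ W (0, 0), forall p q, W p -> W q -> W (hadd p q)
    & forall p, W p -> W (hopp p)].

Definition is_submodule W : Prop :=
  is_hsubgroup W /\ forall p a, W p -> W (hact p a).

Definition hact_set A B : set (K * K) :=
  smallest is_hsubgroup [set hact p b | p in A & b in B].

Definition htr p : K :=
  bar F p.1 * mu F * p.1 + p.2 + bar F p.2 * lam F.

Definition Delta_min : set (K * K) := [set (0, x - bar F x * lam F) | x in setT].

Definition Delta_max : set (K * K) := [set p | htr p = 0].

End Heisenberg.

Record hermitian_form_field (K : fieldType) := HermitianFormField {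
  pre_of :> pre_hermitian K;
  Delta : set (K * K);
  Delta_submodule : is_submodule pre_of Delta;
  Delta_min_sub : Delta_min pre_of `<=` Delta;
  Delta_sub_max : Delta `<=` Delta_max pre_of
}.

Section OddFormIdeals.
Variables (K : fieldType) (F : hermitian_form_field K).
Implicit Types (I : set K) (W : set (K * K)).

Definition J_Delta : set K := [set y | exists z, Delta F (y, z)].

Definition is_bar_ideal I : Prop :=
  [/\ I 0, forall x y, I x -> I y -> I (x + y),
      forall a x, I x -> I (a * x)
    & forall x, I x -> I (bar F x)].

Definition ideal_tilde I : set K :=
  [set x | forall y, J_Delta y -> I (bar F y * mu F * x)].

Definition Omega_min I : set (K * K) :=
  [set hadd F p q | p in [set (0, x - bar F x * lam F) | x in I]
                  & q in hact_set F (Delta F) I].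

Definition Omega_max I : set (K * K) := Delta F `&` (ideal_tilde I `*` I).

Definition odd_form_ideal I W : Prop :=
  [/\ is_bar_ideal I, is_submodule F W, Omega_min I `<=` W
    & W `<=` Omega_max I].

End OddFormIdeals.

(* The index list (1, ..., n, 0, -n, ..., -1) is identified, in this order,
   with 'I_(2n+1): i > 0 is at position i - 1, 0 at position n, and -i at the
   position symmetric to that of i, so that i |-> -i is [rev_ord]. *)
Definition mid (n : nat) : 'I_(n.*2.+1) := inord n.

Definition hb (n : nat) (i : 'I_(n.*2.+1)) : bool := i != mid n.

Definition eps (n : nat) (i : 'I_(n.*2.+1)) : int :=
  if (i < n)%N then 1 else -1.

Section Unitary.
Variables (K : fieldType) (F : hermitian_form_field K) (n : nat).
Notation idx := ('I_(n.*2.+1)).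
Notation mx := ('M[K]_(n.*2.+1)).
Notation cvec := ('cV[K]_(n.*2.+1)).
Implicit Types (s t : mx) (u v : cvec) (i j : idx).
Implicit Types (I : set K) (W : set (K * K)).

Definition formB u v : K :=
  \sum_(i < n.*2.+1 | (i < n)%N) bar F (u i 0) * v (rev_ord i) 0
  + bar F (u (mid n) 0) * mu F * v (mid n) 0
  + \sum_(i < n.*2.+1 | (n < i)%N) bar F (u i 0) * lam F * v (rev_ord i) 0.

Definition formQ u : K * K :=
  (u (mid n) 0,
   \sum_(i < n.*2.+1 | (i < n)%N) bar F (u i 0) * u (rev_ord i) 0).

Definition U : set mx :=
  [set s | [/\ s \is a GRing.unit,
               forall u v, formB (s *m u) (s *m v) = formB u v
             & forall u, Delta F (hsub F (formQ (s *m u)) (formQ u))]].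

(* All integer divisions by 2 in the next two definitions are exact. *)
Definition short_root i j (x : K) : mx :=
  1 + x *: delta_mx i j
  - (lam F ^ ((eps j - 1) %/ 2)%Z * bar F x * lam F ^ ((1 - eps i) %/ 2)%Z)
      *: delta_mx (rev_ord j) (rev_ord i).

Definition extra_short_root i (p : K * K) : mx :=
  1 + p.1 *: delta_mx (mid n) (rev_ord i)
  - (lam F ^ (- ((1 + eps i) %/ 2)%Z) * bar F p.1 * mu F) *: delta_mx i (mid n)
  + p.2 *: delta_mx i (rev_ord i).

(* Omega^1 and Omega^{-1}; only used for k = 1 and k = -1. *)
Definition signed_set W (k : int) : set (K * K) :=
  if k == 1 then W else [set p | W (p.1, bar F p.2)].

Definition short_index i j : Prop :=
  [/\ hb i, hb j, i != j & i != rev_ord j].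

(* For (I, W) = (setT, Delta F) these are all short and extra short root
   transvections. *)
Definition elementary I W : set mx :=
  [set s | (exists i j x, [/\ short_index i j, I x & s = short_root i j x])
        \/ (exists i p, [/\ hb i, signed_set (Delta F) (- eps i) p,
              signed_set W (- eps i) p & s = extra_short_root i p])].

Definition EU : set mx := gen (elementary setT (Delta F)).

Definition EU_rel I W : set mx := normal_closure EU (gen (elementary I W)).

Definition U_rel I W : set mx :=
  [set s | [/\ U s,
      forall i j, hb i -> hb j -> I (s i j - (i == j)%:R)
    & forall u, J_Delta F (u (mid n) 0) ->
        W (hsub F (formQ (s *m u)) (formQ u))]].

Definition NU I W : set mx := normaliser U (U_rel I W).

Definition CU I W : set mx :=
  [set s | NU I W s /\ commutator_subgroup s EU `<=` U_rel I W].

(* For n >= 3 and H a subgroup of U normalised by EU, exactly one (I, W)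
   satisfies this predicate. *)
Definition has_level (H : set mx) I W : Prop :=
  [/\ odd_form_ideal F I W, EU_rel I W `<=` H & H `<=` CU I W].

Definition classes_of_level I W : set (set mx) :=
  [set C | conjugacy_class U C /\ has_level (gen C) I W].

Definition short_transvections : set mx :=
  [set s | (exists i j x, short_index i j /\ s = short_root i j x) /\ s != 1].

End Unitary.

Arguments classes_of_level {K} F n I W _.
Arguments short_transvections {K} F n _.

(* Main.v *)
Require Import Defs.
From mathcomp Require Import all_boot all_order all_algebra ring.
From mathcomp Require Import boolp classical_sets.

Import GRing.Theory.
Local Open Scope classical_set_scope.
Local Open Scope ring_scope.

Set Implicit Arguments.
Unset Strict Implicit.

(**
In characteristic 2 with trivial involution, lambda = -1 = 1, mu = 0 and
Delta = K * K, the form B becomes an alternating form on M = K^(2n+1) whose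
radical is spanned by e_0, the condition on Q is empty, and G is the group of
all isometries of B ([U_isom]).  Two families of isometries matter:
-  [transv a v], which is x |-> x + a B(v, x) v, and
-  [hyperbolic p q], which is x |-> x + B(p, x) q + B(q, x) p for B(p, q) = 0.
Conjugating by an isometry g replaces v, p, q by gv, gp, gq.  The short root
transvections are the [hyperbolic p q] with (p, q) = (e_i, x e_{-j}), and G is
transitive on the pairs (p, q) spanning a totally isotropic plane that
misses the radical ([isom_transitive_pair]), so one of them is as good as any
other.

Upper bound.  A class of level (K, Delta) cannot consist of elements acting
trivially modulo the radical ([level_nontrivial]), so let s act nontrivially.
For t a transvection along v put rho = [t, s], the product of transvections
along v and sv.  If rho fixes r and B(r, z) = B(rho z, z) = 0, then
[rho, hyperbolic r z] = hyperbolic r (rho z + z), and a double commutator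
[[t, s], h] is a product of four conjugates of s and s^-1.  It remains to find
v, z and r.  If some v has b = B(v, sv) <> 0, the multiplier of t can be
scaled so that rho has an eigenvalue a^2 <> 1 in K on the plane <v, sv>; take z
to be an eigenvector and r orthogonal to v and sv.  If B(v, sv) = 0 for all v,
then for some v the vectors v and sv are independent modulo the radical
([isom_nontrivialP]); take z with B(z, v) = B(z, sv) = 1 and r orthogonal to
v, sv and z, for which n >= 3 leaves room.

Lower bound.  Let s be a transvection composed with multiplication of e_0 by
c, where c has order at least 4.  Elements of the class of s and their
inverses multiply e_0 by c or c^-1, so a product of one or three of them does
not fix e_0, whereas a short root transvection does.  Modulo the radical they
are transvections, and a product of two transvections along u and w with
B(x, Tx) = 0 for all x is trivial, which excludes products of two
([hyperbolic_notin_setpow3]).  That the class of s has level (K, Delta)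
follows from the upper bound: it generates every short root transvection, and
products of three [hyperbolic r _] give the extra short ones
([gen_class_level]).
*)

(** * Least values in the extended naturals *)

Lemma le_leastP (P : nat -> Prop) (m : nat) :
  oleq (least P) m <-> exists2 k, (k <= m)%N & P k.
Proof.
rewrite /least; case: pselect => [exP|nexP] /=.
  case: ex_minnP => k /asboolP Pk minP; split=> [lekm|[j lejm Pj]].
    by exists k.
  by apply: leq_trans lejm; apply/minP/asboolP.
split=> // -[k _ Pk]; apply: nexP; exists k; exact/asboolP.
Qed.

Lemma least_eq (P : nat -> Prop) (m : nat) :
  P m -> (forall k, P k -> (m <= k)%N) -> least P = Some m.
Proof.
move=> Pm minm; rewrite /least; case: pselect => [exP|]; last first.
  by case; exists m; apply/asboolP.
case: ex_minnP => k /asboolP Pk mink; congr Some.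
by apply/eqP; rewrite eqn_leq minm // mink //; apply/asboolP.
Qed.

(** * Groups of units *)

Section GroupsOfUnits.
Variable R : unitRingType.
Implicit Types (A X H : set R) (x g h : R).

Lemma unit_invol x : x * x = 1 -> x \is a GRing.unit.
Proof. by move=> ss; apply/unitrP; exists x. Qed.

Lemma invr_invol x : x * x = 1 -> x^-1 = x.
Proof.
by move=> ss; rewrite -[RHS](mulKr (unit_invol ss)) ss mulr1.
Qed.

Lemma sub_gen A : A `<=` gen A. Proof. exact: sub_gen_smallest. Qed.

Lemma gen_min A H : is_subgroup H -> A `<=` H -> gen A `<=` H.
Proof. exact: smallest_sub. Qed.

Lemma gen_subgroup A H : is_subgroup H -> A `<=` H -> is_subgroup (gen A).
Proof.
move=> sH AH; split=> [x|H' [] []||]//.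
- by move=> /(gen_min sH AH); case: sH => + _ _ _; apply.
- move=> x y Ax Ay H' [sH' AH']; have [_ _ mulH' _] := sH'.
  by apply: mulH'; [apply: Ax | apply: Ay].
by move=> x Ax H' [sH' AH']; have [_ _ _ invH'] := sH'; apply: invH'; apply: Ax.
Qed.

Lemma setpow_sub X H m : is_subgroup H -> X `<=` H -> setpow X m `<=` H.
Proof.
move=> [_ H1 HM _] XH; elim: m => [|m IHm] x /=; first by move->.
by move=> [y /XH Hy [z /IHm Hz <-]]; apply: HM.
Qed.

Lemma setpow_conj X g m x : g \is a GRing.unit ->
    (forall h, X h -> X (g * h * g^-1)) ->
  setpow X m x -> setpow X m (g * x * g^-1).
Proof.
move=> Ug Xg; elim: m x => [x ->|m IHm _ [h Xh] [h' /IHm Xh' <-]] /=.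
  by rewrite mulr1 divrr.
exists (g * h * g^-1); first exact: Xg.
by exists (g * h' * g^-1) => //; rewrite !mulrA mulrVK.
Qed.

Lemma normaliser_id H : is_subgroup H -> normaliser H H = H.
Proof.
move=> [HU H1 HM HV]; apply/seteqP; split=> [x []//|x Hx]; split=> //.
apply/seteqP; split=> [_ [y Hy <-]|y Hy].
  by apply: (HM _ _ (HM _ _ Hx Hy)); apply: HV.
exists (x^-1 * y * x); first by apply: (HM _ _ (HM _ _ (HV _ Hx) Hy)).
by rewrite !mulrA divrr ?mul1r ?mulrK // HU.
Qed.

Lemma normal_closure_id H : is_subgroup H -> normal_closure H H = H.
Proof.
move=> sH; apply/seteqP; split; last exact: sub_gen_smallest.
apply: smallest_sub => //; split=> // g x Hg Hx.
by have [_ _ HM HV] := sH; apply: (HM _ _ (HM _ _ Hg Hx)); apply: HV.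
Qed.

End GroupsOfUnits.

(** * Linear algebra *)

Lemma mulmx_col_inj (K : fieldType) (m : nat) (s t : 'M[K]_m) :
  (forall x : 'cV[K]_m, s *m x = t *m x) -> s = t.
Proof.
by move=> st; apply/matrixP=> i j; have /colP/(_ i) := st (delta_mx j 0);
  rewrite -!colE !mxE.
Qed.

Lemma exists_common_zero (K : fieldType) (k m : nat) (A : 'M[K]_(k, m)) :
  (k < m)%N -> exists2 x : 'cV[K]_m, x != 0 & A *m x = 0.
Proof.
move=> ltkm; have ntC : cokermx A != 0.
  rewrite -mxrank_eq0 mxrank_coker subn_eq0 -ltnNge.
  exact: leq_ltn_trans (rank_leq_row A) ltkm.
have [j ntj] : exists j, col j (cokermx A) != 0.
  apply/existsP; apply: contra_neqT ntC; rewrite negb_exists => /forallP all0.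
  apply/matrixP=> i j; have /negPn/eqP/colP/(_ i) := all0 j.
  by rewrite !mxE.
by exists (col j (cokermx A)); rewrite // colE mulmxA mulmx_coker mul0mx.
Qed.

(** * The alternating form *)

Section Form.
Variables (K : fieldType) (n : nat).
Hypothesis char2 : 2%N \in [pchar K].
Notation idx := ('I_(n.*2.+1)).
Notation mx := ('M[K]_(n.*2.+1)).
Notation vec := ('cV[K]_(n.*2.+1)).
Implicit Types (s t g h : mx) (u v w x y z p q r : vec).
Implicit Types (i j k : idx) (a b c : K).

Let two : 2 = 0 :> K. Proof. exact: pcharf0 char2. Qed.

Lemma val_mid : mid n = n :> nat.
Proof. by rewrite inordK // ltnS -addnn leq_addr. Qed.

Lemma rev_mid : rev_ord (mid n) = mid n.
Proof. by apply: val_inj; rewrite /= val_mid subSS -addnn addnK. Qed.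

Lemma rev_eq_mid i : (rev_ord i == mid n) = (i == mid n).
Proof. by rewrite -{1}rev_mid (inj_eq rev_ord_inj). Qed.

(** The row vector representing [symp u]; its entry at e_0 vanishes, which
    makes e_0 span the radical. *)
Definition flat u : 'rV[K]_(n.*2.+1) :=
  \row_j (u (rev_ord j) 0 *+ (j != mid n)).

Definition symp u v : K := (flat u *m v) 0 0.

Lemma sympDl u v w : symp (u + v) w = symp u w + symp v w.
Proof.
rewrite /symp (_ : flat (u + v) = flat u + flat v) ?mulmxDl ?mxE //.
by apply/rowP=> j; rewrite !mxE mulrnDl.
Qed.

Lemma sympZl a u w : symp (a *: u) w = a * symp u w.
Proof.
rewrite /symp (_ : flat (a *: u) = a *: flat u) -?scalemxAl ?mxE //.
by apply/rowP=> j; rewrite !mxE mulrnAr.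
Qed.

Lemma sympDr w u v : symp w (u + v) = symp w u + symp w v.
Proof. by rewrite /symp mulmxDr mxE. Qed.

Lemma sympZr a w u : symp w (a *: u) = a * symp w u.
Proof. by rewrite /symp -scalemxAr mxE. Qed.

Lemma symp_sum u v :
  symp u v = \sum_(i | i != mid n) u i 0 * v (rev_ord i) 0.
Proof.
rewrite /symp mxE (reindex_inj rev_ord_inj) /= [RHS]big_mkcond /=.
apply: eq_bigr => i _; rewrite mxE rev_ordK rev_eq_mid.
by case: ifP; rewrite ?mulr0n ?mul0r // mulr1n.
Qed.

Lemma sympC u v : symp u v = symp v u.
Proof.
rewrite !symp_sum (reindex_inj rev_ord_inj) /=.
by apply: eq_big => [i|i _]; rewrite ?rev_eq_mid // rev_ordK mulrC.
Qed.

Lemma symp_halves u v :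
  symp u v = \sum_(i < n.*2.+1 | (i < n)%N) u i 0 * v (rev_ord i) 0
           + \sum_(i < n.*2.+1 | (n < i)%N) u i 0 * v (rev_ord i) 0.
Proof.
rewrite symp_sum (bigID (fun i : idx => (i < n)%N)) /=; congr (_ + _).
  apply: eq_bigl => i; rewrite -val_eqE /= val_mid.
  by case: ltngtP.
by apply: eq_bigl => i; rewrite -val_eqE /= val_mid; case: ltngtP.
Qed.

Lemma sympvv u : symp u u = 0.
Proof.
rewrite symp_halves [X in _ + X](reindex_inj rev_ord_inj) /=.
rewrite [X in _ + X](eq_big (fun i : idx => (i < n)%N)
  (fun i => u i 0 * u (rev_ord i) 0)) => [|i|i _]; last 2 first.
- by rewrite ltn_subRL addSn ltnS [X in (_ < X)%N](esym (addnn n)) ltn_add2r.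
- by rewrite rev_ordK mulrC.
exact: addrr_pchar2.
Qed.

Definition sympE := (sympDl, sympDr, sympZl, sympZr).

Definition ebase i : vec := delta_mx i 0.

Lemma symp_ebasel i v : i != mid n -> symp (ebase i) v = v (rev_ord i) 0.
Proof.
move=> nti; rewrite symp_sum (bigD1 i) //= big1 => [|k /andP[_ /negPf neki]].
  by rewrite mxE !eqxx mul1r addr0.
by rewrite mxE neki mul0r.
Qed.

Lemma symp_ebase0 v : symp v (ebase (mid n)) = 0.
Proof.
rewrite symp_sum big1 // => i nti.
by rewrite mxE rev_eq_mid (negPf nti) mulr0.
Qed.

Lemma symp_ebase i j : i != mid n ->
  symp (ebase i) (ebase j) = (rev_ord i == j)%:R.
Proof. by move=> nti; rewrite symp_ebasel // mxE andbT. Qed.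

(** * Transvections and hyperbolic involutions *)

Definition transv a v : mx := 1 + a *: (v *m flat v).
Definition hyperbolic p q : mx := 1 + (q *m flat p + p *m flat q).

Lemma dyadE p q x : q *m flat p *m x = symp p x *: q.
Proof. by rewrite -mulmxA [flat p *m x]mx11_scalar mul_mx_scalar. Qed.

Lemma transvE a v x : transv a v *m x = x + (a * symp v x) *: v.
Proof. by rewrite mulmxDl mul1mx -scalemxAl dyadE scalerA. Qed.

Lemma hyperbolicE p q x :
  hyperbolic p q *m x = x + (symp p x *: q + symp q x *: p).
Proof. by rewrite mulmxDl mul1mx mulmxDl !dyadE. Qed.

Lemma mulE s t x : (s * t) *m x = s *m (t *m x).
Proof. exact: esym (mulmxA _ _ _). Qed.

Lemma transvK a v : transv a v * transv a v = 1.
Proof.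
apply: mulmx_col_inj => x; rewrite mulE !transvE !sympE sympvv mul1mx.
by apply/colP=> i; rewrite !mxE; ring: two.
Qed.

(** The involutions sharing the vector r multiply additively in the other
    argument only up to a transvection along r, the center of a Heisenberg
    group; this is how they generate transvections. *)
Lemma hyperbolicM r p q : symp r p = 0 -> symp r q = 0 ->
  hyperbolic r p * hyperbolic r q = transv (symp p q) r * hyperbolic r (p + q).
Proof.
move=> rp rq; apply: mulmx_col_inj => x.
rewrite !mulE transvE !hyperbolicE !sympE !(sympC _ r) sympvv rp rq.
by apply/colP=> i; rewrite !mxE; ring: two.
Qed.

Lemma transv0 v : transv 0 v = 1. Proof. by rewrite /transv scale0r addr0. Qed.

Lemma hyperbolic0 p : hyperbolic p 0 = 1.
Proof.
apply: mulmx_col_inj => x; rewrite hyperbolicE mul1mx scaler0 add0r.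
by rewrite -(scale0r 0) sympZl mul0r scale0r addr0.
Qed.

Lemma hyperbolicK p q : symp p q = 0 -> hyperbolic p q * hyperbolic p q = 1.
Proof.
move=> pq; rewrite hyperbolicM // sympvv transv0 mul1r.
rewrite (_ : q + q = 0) ?hyperbolic0 //.
by apply/colP=> i; rewrite !mxE; ring: two.
Qed.

(** * The isometry group and its transitivity *)

Definition isom : set mx := [set s | s \is a GRing.unit /\
  forall u v, symp (s *m u) (s *m v) = symp u v].

Lemma isom_subgroup : is_subgroup isom.
Proof.
split=> [s [] //||s t [Us Is] [Ut It]|s [Us Is]].
- by split=> [|u v]; rewrite ?unitr1 // !mul1mx.
- by split=> [|u v]; rewrite ?unitrMr ?Us // !mulE Is It.
split=> [|u v]; rewrite ?unitrV //.
by rewrite -Is -!mulE divrr // !mul1mx.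
Qed.

Lemma isomM s t : isom s -> isom t -> isom (s * t).
Proof. by case: isom_subgroup => _ _ + _; apply. Qed.

Lemma isomV s : isom s -> isom s^-1.
Proof. by case: isom_subgroup => _ _ _; apply. Qed.

Lemma isom_transv a v : isom (transv a v).
Proof.
split=> [|x y]; first exact/unit_invol/transvK.
by rewrite !transvE !sympE sympvv (sympC x v); ring: two.
Qed.

Lemma isom_hyperbolic p q : symp p q = 0 -> isom (hyperbolic p q).
Proof.
move=> pq; split=> [|x y]; first exact/unit_invol/hyperbolicK.
rewrite !hyperbolicE !sympE !sympvv (sympC q p) pq (sympC x p) (sympC x q).
by ring: two.
Qed.

Lemma conj_eq s t h : h \is a GRing.unit -> h * s = t * h -> h * s * h^-1 = t.
Proof. by move=> Uh ->; rewrite mulrK. Qed.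

Lemma conj_transv s a v : isom s ->
  s * transv a v * s^-1 = transv a (s *m v).
Proof.
move=> [Us Is]; apply: conj_eq => //; apply: mulmx_col_inj => x.
by rewrite !mulE !transvE Is mulmxDr -scalemxAr.
Qed.

Lemma conj_hyperbolic s p q : isom s ->
  s * hyperbolic p q * s^-1 = hyperbolic (s *m p) (s *m q).
Proof.
move=> [Us Is]; apply: conj_eq => //; apply: mulmx_col_inj => x.
by rewrite !mulE !hyperbolicE !Is !mulmxDr -!scalemxAr.
Qed.

(** Since the equations also include the vanishing of the e_0-coordinate, q is
    found outside the radical; z witnesses this. *)
Lemma exists_orth (ps : seq vec) : (size ps < n.*2)%N ->
  exists q z, symp z q = 1 /\ {in ps, forall p, symp p q = 0}.
Proof.
move=> ltps.
pose A := col_mx (delta_mx (0 : 'I_1) (mid n))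
  (\matrix_(i < size ps) flat ps`_i).
have [|q nzq /eqP] := @exists_common_zero _ _ _ A; first exact: ltps.
rewrite mul_col_mx col_mx_eq0 -rowE => /andP[/eqP q0 /eqP qps].
have [i nzqi] : exists i, q i 0 != 0.
  apply/existsP; apply: contra_neqT nzq; rewrite negb_exists => /forallP qi0.
  by apply/colP=> i; have /negPn/eqP := qi0 i; rewrite mxE.
have nti : i != mid n.
  apply: contraNneq nzqi => ->.
  by have /rowP/(_ 0) := q0; rewrite !mxE => ->.
exists q, ((q i 0)^-1 *: ebase (rev_ord i)); split=> [|p].
  by rewrite sympZl symp_ebasel ?rev_eq_mid // rev_ordK mulVf.
move=> /(nthP 0)[j ltj <-]; rewrite /symp -[j]/(val (Ordinal ltj)).
have /(congr1 (row (Ordinal ltj))) := qps.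
by rewrite row_mul rowK row0 => ->; rewrite mxE.
Qed.

(** The last two conditions say that the functionals B(p, _) and B(q, _) are
    linearly independent, that is, p and q are independent modulo the radical.
    In this dual form the property is transported by isometries and checked
    by exhibiting vectors. *)
Definition isotropic_pair p q : Prop :=
  [/\ symp p q = 0, exists2 z, symp z p != 0 & symp z q = 0
    & exists2 z, symp z q != 0 & symp z p = 0].

(** Adding a multiple of z to y makes it orthogonal to q. *)
Lemma isotropic_pairI p q y z : symp p q = 0 -> symp y p != 0 ->
  symp z p = 0 -> symp z q != 0 -> isotropic_pair p q.
Proof.
move=> pq yp zp zq; split=> //; last by exists z.
exists (y + (symp y q / symp z q) *: z); rewrite sympDl sympZl.
  by rewrite zp mulr0 addr0.
by rewrite divfK // addrr_pchar2.
Qed.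

Lemma transv_swap u v : symp u v != 0 ->
  transv (symp u v)^-1 (u + v) *m u = v.
Proof.
move=> nz; rewrite transvE sympDl sympvv add0r (sympC v) mulVf // scale1r.
by apply/colP=> i; rewrite !mxE; ring: two.
Qed.

Lemma transv_fix a v w : symp v w = 0 -> transv a v *m w = w.
Proof. by move=> vw; rewrite transvE vw mulr0 scale0r addr0. Qed.

(** If z is orthogonal to neither u nor v, the transvections along u + z and
    z + v carry u to z to v, and they fix w when z is orthogonal to w.  The
    hypotheses on u and v guarantee such a z.  With w = 0 this is plain
    transitivity. *)
Lemma isom_transitive_fix w u v : symp u w = 0 -> symp v w = 0 ->
    (exists2 z, symp z u != 0 & symp z w = 0) ->
    (exists2 z, symp z v != 0 & symp z w = 0) ->
  exists2 g, isom g & g *m w = w /\ g *m u = v.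
Proof.
move=> uw vw [y yu yw] [x xv xw].
have [z [zu zv zw]] : exists z,
    [/\ symp u z != 0, symp z v != 0 & symp z w = 0].
  have [yv0|yv] := eqVneq (symp y v) 0; last first.
    by exists y; rewrite sympC.
  have [xu0|xu] := eqVneq (symp x u) 0; last first.
    by exists x; rewrite sympC.
  exists (x + y).
  by rewrite sympC !sympDl xu0 yv0 add0r addr0 xw yw addr0.
exists (transv (symp z v)^-1 (z + v) * transv (symp u z)^-1 (u + z)).
  by apply: isomM; apply: isom_transv.
rewrite !mulE !transv_swap // !transv_fix // sympDl ?uw ?zw ?vw ?addr0 //.
Qed.

Lemma isom_transitive_pair p q p' q' :
    isotropic_pair p q -> isotropic_pair p' q' ->
  exists2 g, isom g & g *m p = p' /\ g *m q = q'.
Proof.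
move=> [pq [x xp xq] [y yq yp]] [pq' [x' xp' xq'] [y' yq' yp']].
have s0 z : symp z 0 = 0 by rewrite -(scale0r z) sympZr mul0r.
have [g Ig [_ gp]] : exists2 g, isom g & g *m 0 = 0 :> vec /\ g *m p = p'.
  by apply: isom_transitive_fix; rewrite ?s0 //; [exists x | exists x'].
have [Ug Sg] := Ig.
have [h Ih [hp hq]] : exists2 h, isom h & h *m p' = p' /\ h *m (g *m q) = q'.
  apply: isom_transitive_fix; first by rewrite -gp Sg sympC.
  - by rewrite sympC.
  - by exists (g *m y); rewrite -?gp Sg.
  - by exists y'.
by exists (h * g); rewrite ?mulE ?gp //; apply: isomM.
Qed.

(** * Every short root transvection is a product of four conjugates *)

(** By conjugation the commutator is the product of [hyperbolic r (s z)] and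
    [hyperbolic r z]; the transvection factor in [hyperbolicM] disappears
    because s z is orthogonal to z. *)
Lemma commutator_hyperbolic s r z : isom s -> s *m r = r -> symp r z = 0 ->
    symp (s *m z) z = 0 ->
  s * hyperbolic r z * s^-1 * (hyperbolic r z)^-1 = hyperbolic r (s *m z + z).
Proof.
move=> Is sr rz szz; have [Us Ss] := Is.
rewrite conj_hyperbolic // sr.
rewrite (invr_invol (hyperbolicK rz)).
by rewrite hyperbolicM ?szz ?transv0 ?mul1r // -{1}sr Ss.
Qed.

Definition trivial_mod_rad s : Prop :=
  forall x v, symp x (s *m v) = symp x v.

(** If both alternatives failed, s would preserve each line modulo the radical,
    and v would always be orthogonal to s v.  The multiplier of s on v and w
    would then be the same whenever B(v, w) <> 0, and its square 1 as s is an
    isometry; in characteristic 2 this makes s trivial.  Independence of v and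
    s v is expressed by a dual pair d1, d2. *)
Lemma isom_nontrivialP s : isom s -> ~ trivial_mod_rad s ->
  (exists v, symp v (s *m v) != 0) \/
  (exists v d1 d2, [/\ symp v (s *m v) = 0, symp d1 v = 1,
     symp d1 (s *m v) = 0, symp d2 v = 0 & symp d2 (s *m v) = 1]).
Proof.
move=> [Us Is] nts.
case: (pselect (exists v, symp v (s *m v) != 0)); first by left.
move=> /forallNP/(_ _)/negP/negPn/eqP perp; right; apply: contrapT => nodual.
(* If a minor were nonzero, Cramer's rule would produce d1 and d2. *)
have minor v x y : symp x v * symp y (s *m v) = symp y v * symp x (s *m v).
  apply: contra_notP nodual => /eqP; set u := s *m v => ntD.
  pose D := symp x v * symp y u + symp y v * symp x u.
  have nzD : D != 0 by rewrite addr_eq0 oppr_pchar2.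
  exists v, (D^-1 *: (symp y u *: x + symp x u *: y)),
    (D^-1 *: (symp y v *: x + symp x v *: y)).
  rewrite !sympE -/u; split; first exact: perp.
  - by rewrite -[RHS](mulVf nzD) /D; ring.
  - by ring: two.
  - by ring: two.
  by rewrite -[RHS](mulVf nzD) /D; ring.
apply: nts => w v.
have nz x y : symp x y != 0 -> symp x (s *m y) = symp x y.
  move=> nzxy; have := minor (x + y) x y.
  rewrite mulmxDr !sympE !sympvv !perp (sympC y x) !add0r !addr0.
  move=> /(mulfI nzxy) exy; have := minor y x (s *m x).
  rewrite Is (sympC (s *m x)) exy => /esym/eqP.
  by rewrite -!expr2 eqf_sqr oppr_pchar2 // orbb => /eqP.
have [wv0|/nz//] := eqVneq (symp w v) 0.
have [[y yv]|] := pselect (exists y, symp y v != 0).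
  have := minor v w y; rewrite wv0 mul0r => /esym/eqP.
  by rewrite mulf_eq0 (negPf yv) => /eqP.
move=> /forallNP rad; rewrite wv0.
have <- : s *m (s^-1 *m w) = w by rewrite -mulE divrr // mul1mx.
by rewrite Is; apply/eqP/negPn/negP/rad.
Qed.

Section Class.
Variable s : mx.
Hypotheses (Is : isom s) (nts : ~ trivial_mod_rad s).

Definition sym_class : set mx :=
  let C := [set h * s * h^-1 | h in isom] in C `|` [set h^-1 | h in C].

Lemma sym_classJ h : isom h -> sym_class (h * s * h^-1).
Proof. by move=> Ih; left; exists h. Qed.

Lemma sym_classJV h : isom h -> sym_class (h * s^-1 * h^-1).
Proof.
move=> Ih; have [[Uh _] [Us _]] := conj Ih Is.
right; exists (h * s * h^-1); first by exists h.
by rewrite !invrM ?invrK ?mulrA ?unitrMr ?unitrV.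
Qed.

Lemma sym_class_conj g t : isom g -> sym_class t -> sym_class (g * t * g^-1).
Proof.
move=> Ig; have [[Ug _] [Us _]] := conj Ig Is.
have conjC (x : mx) h : isom h ->
    g * (h * x * h^-1) * g^-1 = (g * h) * x * (g * h)^-1.
  by move=> [Uh _]; rewrite invrM // !mulrA.
case=> [[h Ih <-]|[_ [h Ih <-] <-]].
  by rewrite conjC //; apply/sym_classJ/isomM.
have [Uh _] := Ih; rewrite !invrM ?invrK ?unitrMr ?unitrV // mulrA.
by rewrite conjC //; apply/sym_classJV/isomM.
Qed.

(** A double commutator [[g, s], h] consists of two conjugates of s and two
    of its inverse. *)
Lemma setpow4_commutator g h : isom g -> isom h ->
  let t := g * s * g^-1 * s^-1 in
  setpow sym_class 4 (t * h * t^-1 * h^-1).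
Proof.
move=> Ig Ih t; have [[Ug _] [Uh _] [Us _]] := And3 Ig Ih Is.
have I1 : isom 1 by case: isom_subgroup.
exists (g * s * g^-1); first exact: sym_classJ.
exists (1 * s^-1 * 1^-1 * (h * s * h^-1 * (h * g * s^-1 * (h * g)^-1 * 1))).
  exists (1 * s^-1 * 1^-1); first exact: sym_classJV.
  exists (h * s * h^-1 * (h * g * s^-1 * (h * g)^-1 * 1)) => //.
  exists (h * s * h^-1); first exact: sym_classJ.
  exists (h * g * s^-1 * (h * g)^-1 * 1) => //.
  by exists (h * g * s^-1 * (h * g)^-1); [apply/sym_classJV/isomM | exists 1].
rewrite /t !invrM ?unitrMr ?unitrV // !invrK invr1 !mulr1 mul1r !mulrA.
by rewrite mulrVK.
Qed.

(** The element a different from 0 and 1 serves to make the eigenvalue a^2 of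
    the first commutator different from 1. *)
Lemma exists_hyperbolic_setpow4 a : a != 0 -> a != 1 -> (2 < n)%N ->
  exists p q, isotropic_pair p q /\ setpow sym_class 4 (hyperbolic p q).
Proof.
move=> nz0 nz1 n3.
have n4 : (4 < n.*2)%N by apply: (@leq_trans 3.*2); rewrite ?leq_double.
have comm b v r z :
    let t := transv b v * transv b (s *m v) in
    t *m r = r -> symp r z = 0 -> symp (t *m z) z = 0 ->
  setpow sym_class 4 (hyperbolic r (t *m z + z)).
  move=> t tr rz tzz.
  have Ib := isom_transv b v.
  rewrite -commutator_hyperbolic //; last by apply: isomM; apply: isom_transv.
  rewrite (_ : t = transv b v * s * (transv b v)^-1 * s^-1).
    by apply: setpow4_commutator => //; apply: isom_hyperbolic.
  by rewrite (invr_invol (transvK _ _)) /t -conj_transv // !mulrA.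
case: (isom_nontrivialP Is nts) => [[v nzb]|[v [d1 [d2 [vu d1v d1u d2v d2u]]]]].
- set u := s *m v in nzb; set b := symp v u in nzb.
  (* t has trace 2 + (c b)^2 on the plane <v, u>; with c b = a + 1/a its
     eigenvalues there are a^2 and a^-2, and z is an eigenvector for a^2. *)
  pose k := a + a^-1; pose c := k / b; pose t := transv c v * transv c u.
  have cb : c * b = k by rewrite divfK.
  have ak : a * k = a ^+ 2 + 1 by rewrite mulrDr divff.
  have [|r [y [yr rps]]] := @exists_orth [:: v; u]; first exact: leq_trans n4.
  have vr : symp v r = 0 by apply: rps; rewrite !inE eqxx.
  have ur : symp u r = 0 by apply: rps; rewrite !inE eqxx orbT.
  pose z := a *: v + u.
  have tz : t *m z = a ^+ 2 *: z.
    rewrite /t mulE !transvE !sympE !sympvv (sympC u v) -/b.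
    clearbody u c k b; apply/colP=> i; rewrite !mxE.
    by ring: two cb ak.
  have nzc : a ^+ 2 + 1 != 0.
    rewrite -[1](expr1n _ 2) -(oppr_pchar2 char2 (1 ^+ 2)) subr_eq0 eqf_sqr.
    by rewrite oppr_pchar2 // orbb.
  have vz : symp v z = b by rewrite /z !sympE sympvv mulr0 add0r.
  have rz : symp z r = 0 by rewrite /z !sympE vr ur mulr0 addr0.
  clearbody z.
  have E : t *m z + z = (a ^+ 2 + 1) *: z by rewrite tz scalerDl scale1r.
  exists r, ((a ^+ 2 + 1) *: z); split; last first.
    rewrite -E; apply: comm => //.
    + by rewrite mulE !transv_fix.
    + by rewrite sympC.
    by rewrite tz sympZl sympvv mulr0.
  apply: (@isotropic_pairI _ _ y v); rewrite // ?yr ?oner_neq0 // sympZr.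
    by rewrite sympC rz mulr0.
  by rewrite vz mulf_neq0.
set u := s *m v in vu d1u d2u.
have [|q [y [yq qps]]] := @exists_orth [:: v; u; d1; d2]; first exact: n4.
have [vq uq d1q d2q] :
    [/\ symp v q = 0, symp u q = 0, symp d1 q = 0 & symp d2 q = 0].
  by split; apply: qps; rewrite !inE eqxx ?orbT.
(* z has product 1 with both v and u, so that t moves z by u + v. *)
pose t := transv 1 v * transv 1 u; pose z := d1 + d2.
have tz : t *m z + z = u + v.
  rewrite /t mulE !transvE /z !sympE vu.
  rewrite ![symp _ d1]sympC ![symp _ d2]sympC d1v d1u d2v d2u.
  by clearbody u; apply/colP=> i; rewrite !mxE; ring: two.
exists q, (u + v); split.
  apply: (@isotropic_pairI _ _ y d1) => //.
  - by rewrite sympC !sympE uq vq addr0.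
  - by rewrite yq oner_neq0.
  by rewrite sympDr d1u d1v add0r oner_neq0.
rewrite -tz; apply: comm => //.
- by rewrite mulE !transv_fix.
- by rewrite sympC /z !sympE d1q d2q addr0.
have -> : t *m z = u + v + z.
  by rewrite -tz; apply/colP=> i; rewrite !mxE; ring: two.
rewrite /z !sympE ![symp _ d1]sympC ![symp _ d2]sympC d1v d1u d2v d2u !sympvv.
by rewrite (sympC d2 d1); ring: two.
Qed.

Lemma hyperbolic_setpow4 a p q :
    a != 0 -> a != 1 -> (2 < n)%N -> isotropic_pair p q ->
  setpow sym_class 4 (hyperbolic p q).
Proof.
move=> nz0 nz1 n3 pq.
have [p' [q' [pq']]] := exists_hyperbolic_setpow4 nz0 nz1 n3.
have [g Ig [<- <-]] := isom_transitive_pair pq' pq; rewrite -conj_hyperbolic //.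
by apply: setpow_conj => [|h]; [case: Ig | apply: sym_class_conj].
Qed.

End Class.

Lemma trivial_subgroup : is_subgroup [set s | isom s /\ trivial_mod_rad s].
Proof.
have [_ I1 _ _] := isom_subgroup.
split=> [s [[]]|||] //=; first by split=> // y v; rewrite mul1mx.
  move=> s t [Is Ts] [It Tt]; split; first exact: isomM.
  by move=> y v; rewrite mulE Ts Tt.
move=> s [Is Ts]; split; first exact: isomV.
by move=> y v; have [Us _] := Is; rewrite -Ts -mulE divrr // mul1mx.
Qed.

Lemma trivial_conj g s : isom g -> trivial_mod_rad s ->
  trivial_mod_rad (g * s * g^-1).
Proof.
move=> Ig Ts y v; have [Ug Sg] := Ig; have [_ SVg] := isomV Ig.
by rewrite -SVg -!mulE !mulrA mulVr // mul1r mulE Ts SVg.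
Qed.

Lemma hyperbolic_nontrivial p q :
  isotropic_pair p q -> ~ trivial_mod_rad (hyperbolic p q).
Proof.
move=> [_ [z zp zq] [y yq _]] /(_ z y)/eqP.
rewrite hyperbolicE !sympE zq mulr0 add0r -subr_eq0 [symp z y + _]addrC addrK.
by rewrite sympC mulf_eq0 (negPf zp) (negPf yq).
Qed.

(** * Classes that need four factors *)

Definition transv_mod_rad u s : Prop :=
  forall y v, symp y (s *m v) = symp y v + symp u y * symp u v.

Lemma transv_mod_rad_conj g u s : isom g -> transv_mod_rad u s ->
  transv_mod_rad (g *m u) (g * s * g^-1).
Proof.
move=> Ig Ts y v; have [Ug Sg] := Ig.
have gK w : g *m (g^-1 *m w) = w by rewrite -mulE divrr // mul1mx.
rewrite -(gK y) -(gK v); move: (g^-1 *m y) (g^-1 *m v) => y' v'.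
by rewrite -mulE mulrVK // mulE !Sg.
Qed.

Lemma transv_mod_rad_inv u s : s \is a GRing.unit -> transv_mod_rad u s ->
  transv_mod_rad u s^-1.
Proof.
move=> Us Ts y v.
have sK : s *m (s^-1 *m v) = v by rewrite -mulE divrr // mul1mx.
move: (s^-1 *m v) sK => w <-.
by rewrite !Ts sympvv mul0r addr0; ring: two.
Qed.

(** Writing T for the product, B(x, T x) equals
    B(w, x)^2 + B(u, x)^2 + B(u, x) B(w, x) B(u, w).  Its vanishing at u gives
    B(u, w) = 0, then everywhere B(u, x) = B(w, x), and the two transvections
    cancel modulo the radical. *)
Lemma hyperbolic_not_transv2 p q s t u w : isotropic_pair p q ->
  transv_mod_rad u s -> transv_mod_rad w t -> hyperbolic p q <> s * t.
Proof.
move=> pq Ts Tt E; apply: (hyperbolic_nontrivial pq) => y v.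
rewrite E mulE Ts !Tt.
have sq z : symp w z ^+ 2 + symp u z ^+ 2 + symp u z * symp w z * symp u w = 0.
  have : symp z (hyperbolic p q *m z) = 0.
    by rewrite hyperbolicE !sympE sympvv !(sympC z); ring: two.
  by rewrite E mulE Ts !Tt sympvv (sympC w u) => <-; ring.
have uw : symp u w = 0.
  have /eqP := sq u; rewrite sympvv expr0n /= !mul0r !addr0.
  by rewrite expf_eq0 /= sympC => /eqP.
have e z : symp w z = symp u z.
  apply/eqP; have /eqP := sq z; rewrite uw mulr0 addr0.
  by rewrite addr_eq0 oppr_pchar2 // eqf_sqr oppr_pchar2 // orbb.
by rewrite !e sympvv; ring: two.
Qed.

Notation e0 := (ebase (mid n)).

Lemma delta_mulmx i j v : delta_mx i j *m v = v j 0 *: ebase i.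
Proof.
apply/colP=> k; rewrite !mxE (bigD1 j) //= big1 => [|l /negPf nlj].
  by rewrite mxE !eqxx !andbT addr0 mulrC.
by rewrite mxE nlj andbF mul0r.
Qed.

(** Isometries preserve the radical. *)
Lemma isom_e0 g : isom g -> exists b, g *m e0 = b *: e0.
Proof.
move=> Ig; have [Ug Sg] := Ig; exists ((g *m e0) (mid n) 0).
apply/colP=> i; rewrite [RHS]mxE [ebase _ i 0]mxE andbT.
have [->|nti] := eqVneq i (mid n); first by rewrite mulr1.
rewrite mulr0 -[i]rev_ordK -symp_ebasel ?rev_eq_mid //.
have <- : g *m (g^-1 *m ebase (rev_ord i)) = ebase (rev_ord i).
  by rewrite -mulE divrr // mul1mx.
by rewrite Sg symp_ebase0.
Qed.

Lemma conj_e0 g s c : isom g -> s *m e0 = c *: e0 ->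
  g * s * g^-1 *m e0 = c *: e0.
Proof.
move=> Ig se; have [b gVe] := isom_e0 (isomV Ig); have [Ug _] := Ig.
by rewrite !mulE gVe -scalemxAr se scalerA mulrC -scalerA -gVe -scalemxAr -mulE
  divrr // mul1mx.
Qed.

Definition dilation c : mx := 1 + (c + 1) *: delta_mx (mid n) (mid n).

Lemma dilationE c v : dilation c *m v = v + ((c + 1) * v (mid n) 0) *: e0.
Proof. by rewrite mulmxDl mul1mx -scalemxAl delta_mulmx scalerA. Qed.

Lemma dilation_e0 c : dilation c *m e0 = c *: e0.
Proof.
rewrite dilationE mxE !eqxx mulr1 -[X in X + _]scale1r -scalerDl addrCA.
by rewrite addrr_pchar2 // addr0.
Qed.

Lemma dilation_trivial c : trivial_mod_rad (dilation c).
Proof. by move=> y v; rewrite dilationE !sympE symp_ebase0 mulr0 addr0. Qed.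

Lemma isom_dilation c : c != 0 -> isom (dilation c).
Proof.
move=> nzc; split=> [|u v]; last first.
  by rewrite dilation_trivial sympC dilation_trivial sympC.
apply/unitrP; exists (dilation c^-1).
have K1 b : b != 0 -> dilation b * dilation b^-1 = 1.
  move=> nzb; apply: mulmx_col_inj => v; rewrite mulE mul1mx !dilationE.
  apply/colP=> i; rewrite !mxE !eqxx mulr1.
  have := divff nzb; move: b^-1 => b' bV.
  have three : 3 = 1 :> K by rewrite [LHS](natrD _ 2 1) two add0r.
  by case: (i == mid n); rewrite /= ?mulr1 ?mulr0; ring: three two bV.
by split; [rewrite -{2}[c]invrK K1 ?invr_eq0 | rewrite K1].
Qed.

Lemma sym_class_e0 s t c : isom s -> c != 0 -> s *m e0 = c *: e0 ->
  sym_class s t -> exists d, (d = c \/ d = c^-1) /\ t *m e0 = d *: e0.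
Proof.
move=> Is nzc se [[h Ih <-]|[_ [h Ih <-] <-]].
  by exists c; split; [left | apply: conj_e0].
exists c^-1; split; first by right.
have Ihs : isom (h * s * h^-1).
  by apply: isomM; [apply: isomM | apply: isomV].
have [Ut _] := Ihs; apply: (scalerI nzc); rewrite scalerA divff // scale1r.
by rewrite scalemxAr -(conj_e0 Ih se) -mulE mulVr // mul1mx.
Qed.

Lemma sym_class_transv s t u : isom s -> transv_mod_rad u s ->
  sym_class s t -> exists w, transv_mod_rad w t.
Proof.
move=> Is su [[h Ih <-]|[_ [h Ih <-] <-]]; exists (h *m u).
  exact: transv_mod_rad_conj.
apply: transv_mod_rad_inv; last exact: transv_mod_rad_conj.
have Ihs : isom (h * s * h^-1).
  by apply: isomM; [apply: isomM | apply: isomV].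
by have [] := Ihs.
Qed.

Lemma transv_dilation u c : transv_mod_rad u (transv 1 u * dilation c).
Proof.
move=> y v; rewrite mulE transvE !sympE dilation_trivial mul1r.
by rewrite [symp u (_ *m v)]dilation_trivial mulrC (sympC y u).
Qed.

Lemma transv_mod_rad_nontrivial u y s : transv_mod_rad u s -> symp u y != 0 ->
  ~ trivial_mod_rad s.
Proof.
move=> su uy /(_ y y)/eqP; rewrite su -subr_eq0 addrC addKr.
by rewrite mulf_eq0 (negPf uy).
Qed.

(** One or three factors are excluded by the action on e_0, where every factor
    is c or c^-1; two factors by [hyperbolic_not_transv2]. *)
Lemma hyperbolic_notin_setpow3 c u p q m : c != 0 -> c != 1 -> c ^+ 3 != 1 ->
    isotropic_pair p q -> (0 < m)%N ->
  setpow (sym_class (transv 1 u * dilation c)) m (hyperbolic p q) -> (3 < m)%N.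
Proof.
move=> nzc nc1 nc3 pq; set s := _ * _.
have Is : isom s by apply: isomM; [apply: isom_transv | apply: isom_dilation].
have se : s *m e0 = c *: e0.
  rewrite mulE dilation_e0 -scalemxAr transvE symp_ebase0.
  by rewrite mulr0 scale0r addr0.
have su : transv_mod_rad u s := transv_dilation u c.
have ce := sym_class_e0 Is nzc se.
have Te : hyperbolic p q *m e0 = e0.
  by rewrite hyperbolicE !symp_ebase0 !scale0r !addr0.
have e1 d : d *: e0 = e0 -> d = 1.
  by move=> /colP/(_ (mid n)); rewrite !mxE !eqxx mulr1.
have cube d : d * d * d = d ^+ 3 by rewrite -expr2 -exprSr.
have cV1 : c^-1 != 1 by rewrite invr_eq1.
have cV3 : c^-1 ^+ 3 != 1 by rewrite exprVn invr_eq1.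
case: m => [|[|[|[|m]]]] // _ /=.
- move=> [x /ce[d [dc xd]] [_ -> E]].
  move: Te; rewrite -E mulr1 xd => /e1 d1; exfalso.
  by case: dc => dc; [move: nc1 | move: cV1]; rewrite -dc d1 eqxx.
- move=> [x /(sym_class_transv Is su)[w xw]].
  move=> [_ [y /(sym_class_transv Is su)[w' yw] [_ -> <-]] E].
  exfalso; move: E; rewrite mulr1 => /esym.
  exact: hyperbolic_not_transv2 pq xw yw.
move=> [x /ce[d [dc xd]]].
move=> [_ [y /ce[d' [dc' yd]] [_ [z /ce[d'' [dc'' zd]] [_ -> <-]] <-]] E].
exfalso; move: Te; rewrite -E mulr1 !mulE.
rewrite zd -!scalemxAr yd -!scalemxAr xd !scalerA.
move=> /e1.
case: dc => ->; case: dc' => ->; case: dc'' => ->.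
all: rewrite ?(mulfV nzc) ?(mulVf nzc) ?mul1r ?mulfK ?mulfVK //.
all: by apply/eqP; rewrite ?cube.
Qed.

End Form.

(** * The unitary group and the level of a class *)

Section FormField.
Variables (K : fieldType) (F : hermitian_form_field K) (n : nat).
Hypotheses (hbar : forall x : K, bar F x = x) (hlam : lam F = -1).
Hypotheses (hmu : mu F = 0) (hDelta : Delta F = [set: K * K]).
Hypotheses (char2 : 2%N \in [pchar K]) (hn : (2 < n)%N).
Notation idx := ('I_(n.*2.+1)).
Notation mx := ('M[K]_(n.*2.+1)).
Notation vec := ('cV[K]_(n.*2.+1)).
Notation isom := (@isom K n).
Implicit Types (i j : idx) (s t : mx) (u v : vec).

Let lam1 : lam F = 1. Proof. by rewrite hlam oppr_pchar2. Qed.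

Lemma formB_symp u v : Defs.formB F u v = symp u v.
Proof.
rewrite /Defs.formB hmu mulr0 mul0r addr0 symp_halves lam1.
by congr (_ + _); apply: eq_bigr => i _; rewrite hbar ?mulr1.
Qed.

Lemma U_isom : @U K F n = isom.
Proof.
apply/seteqP; split=> s [Us] => [Bs _|Bs]; split=> //.
- by move=> u v; rewrite -!formB_symp.
- by move=> u v; rewrite !formB_symp.
by move=> u; rewrite hDelta.
Qed.

Lemma short_root_hyperbolic i j x : short_index i j ->
  short_root F i j x = hyperbolic (ebase _ i) (x *: ebase _ (rev_ord j)).
Proof.
move=> [hbi hbj _ _]; apply: mulmx_col_inj => v.
rewrite hyperbolicE symp_ebasel // sympZl symp_ebasel ?rev_eq_mid // rev_ordK.
rewrite /short_root lam1 !exp1rz hbar mulr1 mul1r.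
rewrite mulmxBl mulmxDl mul1mx -!scalemxAl !delta_mulmx.
by apply/colP=> k; rewrite !mxE oppr_pchar2 //; ring.
Qed.

Lemma short_isotropic_pair i j x : short_index i j -> x != 0 ->
  isotropic_pair (ebase K i) (x *: ebase _ (rev_ord j)).
Proof.
move=> [hbi hbj nij nirj] nzx.
have nrij : (rev_ord i == j) = false.
  by rewrite (can2_eq (@rev_ordK _) (@rev_ordK _)) (negPf nirj).
apply: (@isotropic_pairI _ _ _ _ _ (ebase _ (rev_ord i)) (ebase _ j)) => //.
- by rewrite sympZr symp_ebase // (inj_eq rev_ord_inj) (negPf nij) mulr0.
- by rewrite symp_ebase ?rev_eq_mid // rev_ordK eqxx oner_neq0.
- by rewrite sympC symp_ebase // nrij.
by rewrite sympZr symp_ebase // eqxx mulr1.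
Qed.

Lemma extra_short_root_transv i (p : K * K) : hb i ->
  extra_short_root F i p =
  transv p.2 (ebase _ i) * hyperbolic (ebase _ i) (p.1 *: ebase _ (mid n)).
Proof.
move=> hbi; apply: mulmx_col_inj => v.
rewrite /extra_short_root hmu mulr0 scale0r subr0.
rewrite !mulmxDl mul1mx -!scalemxAl !delta_mulmx mulE hyperbolicE transvE.
rewrite !sympE !(sympC (ebase _ (mid n))) !symp_ebase0 sympvv //.
rewrite !mulr0 !scale0r !addr0 symp_ebasel // !scalerA.
by rewrite [p.1 * _]mulrC.
Qed.

Section Generated.
Variables (s : mx) (a : K).
Hypotheses (nz0 : a != 0) (nz1 : a != 1).
Hypotheses (Is : isom s) (nts : ~ trivial_mod_rad s).
Let C : set mx := [set h * s * h^-1 | h in isom].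

Let sC : is_subgroup (gen C).
Proof.
apply: (gen_subgroup (isom_subgroup K n)) => _ [h Ih <-].
by apply: isomM; [apply: isomM | apply: isomV].
Qed.

Lemma gen_class_hyperbolic p q : isotropic_pair p q -> gen C (hyperbolic p q).
Proof.
move=> pq; apply: (@setpow_sub _ (sym_class s) _ 4 sC); last first.
  exact: (hyperbolic_setpow4 char2 Is nts nz0 nz1 hn pq).
move=> _ [/sub_gen//|[t /sub_gen Ct <-]].
by case: sC => _ _ _; apply.
Qed.

(** By [hyperbolicM] the product of [hyperbolic r p] and [hyperbolic r q] is the
    transvection along r with multiplier B(p, q) times [hyperbolic r (p + q)];
    a further factor [hyperbolic r (p + q + x e_0)] leaves the wanted element.
    The choice q = b z + a p with B(z, p) = 1 makes B(p, q) = b, and since z is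
    orthogonal to r while B(z, _) takes the values 1, a and 1 + a on the three
    second arguments, each of them is independent of r modulo the radical. *)
Lemma gen_class_transv i b x : hb i ->
  gen C (transv b (ebase _ i) * hyperbolic (ebase _ i) (x *: ebase _ (mid n))).
Proof.
move=> hbi; set r := ebase _ i; set s' := ebase K (rev_ord i).
have sr : symp s' r = 1 by rewrite symp_ebase ?rev_eq_mid // rev_ordK eqxx.
have [|p [y [yp ps]]] := @exists_orth _ n [:: r; s'].
  by apply: (@leq_trans 3.*2); rewrite ?leq_double.
have rp : symp r p = 0 by apply: ps; rewrite !inE eqxx.
have sp : symp s' p = 0 by apply: ps; rewrite !inE eqxx orbT.
pose z := y + symp y r *: s'.
have zr : symp z r = 0 by rewrite /z !sympE sr mulr1 addrr_pchar2.
have zp : symp z p = 1 by rewrite /z !sympE sp mulr0 addr0.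
clearbody z.
pose q := b *: z + a *: p.
have rq : symp r q = 0 by rewrite /q !sympE rp sympC zr !mulr0 addr0.
have zq : symp z q = a by rewrite /q !sympE zp sympvv // mulr0 add0r mulr1.
have pq : symp p q = b.
  by rewrite /q !sympE sympvv // mulr0 addr0 sympC zp mulr1.
set xe0 := x *: _.
have wxe0 w : symp w xe0 = 0 by rewrite sympZr symp_ebase0 mulr0.
clearbody q xe0.
have pairI q' : symp r q' = 0 -> symp z q' != 0 -> isotropic_pair r q'.
  move=> rq' zq'; apply: (@isotropic_pairI _ _ _ _ _ s' z);
    by rewrite ?sr ?oner_neq0.
have [_ _ CM _] := sC.
have r3 : symp r (p + q + xe0) = 0 by rewrite !sympDr rp rq wxe0 !addr0.
have z3 : symp z (p + q + xe0) != 0.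
  by rewrite !sympDr zp zq wxe0 addr0 addr_eq0 oppr_pchar2 // eq_sym.
rewrite (_ : _ * _ =
  hyperbolic r p * hyperbolic r q * hyperbolic r (p + q + xe0)).
  have Cp : gen C (hyperbolic r p).
    by apply: gen_class_hyperbolic; apply: pairI; rewrite // zp oner_neq0.
  have Cq : gen C (hyperbolic r q).
    by apply: gen_class_hyperbolic; apply: pairI; rewrite // zq.
  exact: CM _ _ (CM _ _ Cp Cq) (gen_class_hyperbolic (pairI _ r3 z3)).
have r2 : symp r (p + q) = 0 by rewrite sympDr rp rq addr0.
rewrite hyperbolicM // pq -mulrA hyperbolicM // sympDr sympvv // wxe0 addr0.
rewrite transv0 mul1r; congr (_ * hyperbolic _ _).
have := pcharf0 char2 => two.
by apply/colP=> k; rewrite !mxE; ring: two.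
Qed.

(** Any class that is not trivial modulo the radical generates all elementary
    transvections, and for the improper odd form ideal the remaining conditions
    on the level are vacuous. *)
Lemma gen_class_level : has_level F (gen C) [set: K] (Delta F).
Proof.
have Cisom : gen C `<=` isom.
  apply: gen_min => [|_ [h Ih <-]]; first exact: isom_subgroup.
  by apply: isomM; [apply: isomM | apply: isomV].
have elemC : @elementary K F n [set: K] (Delta F) `<=` gen C.
  move=> _ [[i [j [x [ij _ ->]]]]|[i [p [hbi _ _ ->]]]].
    rewrite short_root_hyperbolic //; have [->|nzx] := eqVneq x 0.
      by rewrite scale0r hyperbolic0; case: sC.
    by apply: gen_class_hyperbolic; apply: short_isotropic_pair.
  by rewrite extra_short_root_transv //; apply: gen_class_transv.
have sE := gen_subgroup sC elemC.
have EC : @EU K F n `<=` gen C := gen_min sC elemC.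
have UrelE : @U_rel K F n [set: K] (Delta F) = isom.
  rewrite -U_isom; apply/seteqP; split=> [t []|t Ut]//.
  by split=> // *; rewrite hDelta.
split.
- split; first by split.
  + by have := Delta_submodule F.
  + by rewrite hDelta.
  by move=> p Dp; split=> //; split.
- by rewrite /EU_rel (normal_closure_id sE).
have isomS := isom_subgroup K n.
move=> t /Cisom It; split.
  by rewrite /NU U_isom UrelE normaliser_id.
rewrite UrelE; apply: gen_min => // _ [h /EC/Cisom Ih <-].
by apply: isomM; [apply: isomM; [apply: isomM|apply: isomV] | apply: isomV].
Qed.

End Generated.

Lemma exists_short_index : exists i j, @short_index n i j.
Proof.
pose i : idx := inord 0; pose j : idx := inord 1.
have vi : i = 0%N :> nat by rewrite inordK.
have vj : j = 1%N :> nat by rewrite inordK // ltnS -addnn; case: (n) hn.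
exists i, j; split; rewrite /hb -val_eqE /= ?val_mid ?vi ?vj //.
- by case: (n) hn.
- by case: (n) hn => [|[]].
by rewrite -addnn; case: (n) hn => [|[|[]]].
Qed.

(** The isometries acting trivially modulo the radical form a normal subgroup
    that contains no nontrivial short root transvection. *)
Lemma level_nontrivial s : isom s ->
  has_level F (gen [set h * s * h^-1 | h in isom]) [set: K] (Delta F) ->
  ~ trivial_mod_rad s.
Proof.
move=> Is [_ EC _] ts.
have [i [j ij]] := exists_short_index.
have := hyperbolic_nontrivial (short_isotropic_pair ij (oner_neq0 K)).
rewrite -short_root_hyperbolic //; apply.
have /EC : @EU_rel K F n [set: K] (Delta F) (short_root F i j 1).
  by apply: sub_gen_smallest; apply: sub_gen; left; exists i, j, 1.
move=> Cij.
suff [] : [set t | isom t /\ trivial_mod_rad t] (short_root F i j 1) by [].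
move: Cij; apply: gen_min => [|_ [h Ih <-]]; first exact: trivial_subgroup.
split; last exact: trivial_conj.
by apply: isomM; [apply: isomM | apply: isomV].
Qed.

End FormField.

Unset Implicit Arguments.
Set Strict Implicit.

Theorem theorem36 (K : fieldType) (F : hermitian_form_field K) (n : nat)
    (hbar : forall x : K, bar F x = x)
    (hlam : lam F = -1)
    (hmu : mu F = 0)
    (hDelta : Delta F = Delta_max F)
    (hDelta_max : Delta_max F = [set: K * K])
    (hchar : 2%N \in [pchar K])
    (hord : exists a : K,
       a != 0 /\ forall k : nat, (0 < k < 4)%N -> a ^+ k != 1)
    (hn : (3 <= n)%N) :
  scn_family (classes_of_level F n [set: K] (Delta F)) (short_transvections F n)
  = Some 4%N.
Proof.
have [c [nzc ck]] := hord.
have nc1 : c != 1 := ck 1%N isT.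
have nc3 := ck 3%N isT.
have DT : Delta F = [set: K * K] by rewrite hDelta.
have UE := @U_isom _ _ n hbar hlam hmu DT hchar.
have rootE := @short_root_hyperbolic _ _ n hbar hlam hchar.
apply: least_eq => [_ [_ [[g Ug ->] lev] <-]|m].
  rewrite UE in Ug lev *.
  have ntg := level_nontrivial hbar hlam hchar hn Ug lev.
  apply/le_leastP; exists 4%N => //; split=> // _ [[i [j [x [ij ->]]]] ntx].
  rewrite rootE //.
  apply: (hyperbolic_setpow4 hchar Ug ntg nzc nc1 hn).
  apply: short_isotropic_pair => //.
  by apply: contraNneq ntx => ->; rewrite rootE // scale0r hyperbolic0.
have [i [j ij]] := exists_short_index hn.
have pair1 := short_isotropic_pair hchar ij (oner_neq0 K).
pose s := transv 1 (ebase K i) * dilation n c.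
have Is : @isom K n s.
  by apply: isomM; [apply: isom_transv | apply: isom_dilation].
have nts : ~ trivial_mod_rad s.
  have [hbi _ _ _] := ij.
  apply: (@transv_mod_rad_nontrivial _ _ _ (ebase K (rev_ord i)) _
    (transv_dilation _ _)).
  by rewrite (symp_ebase _ (rev_ord i) hbi) eqxx oner_neq0.
have lev := gen_class_level hbar hlam hmu DT hchar hn nzc nc1 Is nts.
pose C : set 'M[K]_(n.*2.+1) := [set h * s * h^-1 | h in @isom K n].
move=> /(_ (scn C (short_transvections F n))) scnC.
have /le_leastP[k lekm [k0 Sk]] : oleq (scn C (short_transvections F n)) m.
  by apply: scnC; exists C => //; split=> //; exists s; rewrite UE.
apply: leq_trans lekm.
apply: (hyperbolic_notin_setpow3 hchar nzc nc1 nc3 pair1 k0).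
rewrite -rootE //; apply: Sk; split; first by exists i, j, 1.
apply/eqP=> T1; apply: (hyperbolic_nontrivial pair1); rewrite -rootE // T1.
by move=> y v; rewrite mul1mx.
Qed.
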